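(* For all integers $N\ge1$, $\mathrm{ospt}(N)\equiv\mathrm{spt}(N)\pmod 2$.
   Context: $\mathrm{spt}(N)$ is the total number of appearances of the smallest part, summed over all partitions of $N$. For a partition $\lambda$, $\mathrm{rank}(\lambda)$ is the largest part of $\lambda$ minus the number of parts of $\lambda$. Let $o(\lambda)$ be the number of ones in $\lambda$ and $\mu(\lambda)$ the number of parts strictly larger than $o(\lambda)$; $\mathrm{crank}(\lambda)$ is the largest part of $\lambda$ if $o(\lambda)=0$, and $\mu(\lambda)-o(\lambda)$ if $o(\lambda)>0$. $M(m,N)$ (resp. $N(m,N)$) is the number of partitions of $N$ with crank (resp. rank) $m$, with the convention that for $N=1$ one sets $M(0,1)=-1$, $M(1,1)=M(-1,1)=1$ and $M(m,1)=0$ otherwise. Set $M_r^+(N):=\sum_{m\ge1}m^rM(m,N)$, $N_r^+(N):=\sum_{m\ge1}m^rN(m,N)$, and $\mathrm{ospt}(N):=M_1^+(N)-N_1^+(N)$. A theorem of Andrews states that $\mathrm{spt}(N)=M_2^+(N)-N_2^+(N)$. *)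

(* Defs.v *)
From HB Require Import structures.
From mathcomp Require Import all_boot all_order all_algebra.

Set Implicit Arguments.
Unset Strict Implicit.
Unset Printing Implicit Defensive.

Import Order.TTheory GRing.Theory Num.Theory.

Definition is_intpart (N : nat) (s : seq nat) : bool :=
  [&& sorted geq s, 0 \notin s & sumn s == N].

Record intpart (N : nat) : Type :=
  IntPart { parts :> seq nat; _ : is_intpart N parts }.

HB.instance Definition _ N := [isSub for @parts N].
HB.instance Definition _ N := [Countable of intpart N by <:].

Lemma intpartP N (la : intpart N) : is_intpart N la.
Proof. exact: valP. Qed.

(* Weakly decreasing sequences of positive integers of sum n whose parts are at
   most b; k is a recursion bound, and k >= n is enough.  Only used to equip
   [intpart N] with its finType structure. *)
Fixpoint enum_intpart (k b n : nat) : seq (seq nat) :=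
  if n == 0 then [:: [::]] else
  if k is k'.+1 then
    [seq x :: s | x <- iota 1 (minn b n), s <- enum_intpart k' x (n - x)]
  else [::].

Lemma nil_partE b s :
  (s == [::]) = [&& path geq b s, 0 \notin s & sumn s == 0].
Proof. by case: s => [|[|x] s] //=; rewrite ?inE ?eqxx !andbF. Qed.

Lemma mem_enum_intpart k b n s : n <= k ->
  (s \in enum_intpart k b n) =
  [&& path geq b s, 0 \notin s & sumn s == n].
Proof.
elim: k b n s => [|k IHk] b n s lenk /=.
  by move: lenk; rewrite leqn0 => /eqP->; rewrite eqxx mem_seq1 (nil_partE b).
case: eqVneq => [->|n0]; first by rewrite mem_seq1 (nil_partE b).
have sub_le x : 0 < x -> n - x <= k.
  by move=> x0; rewrite -ltnS (leq_trans _ lenk) // ltn_subrL x0 lt0n.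
apply/allpairsPdep/idP => [[x [t [xb]]]|].
  have /andP[x_gt0 xle] : (0 < x) && (x <= minn b n).
    by move: xb; rewrite mem_iota add1n ltnS.
  move: xle; rewrite leq_min => /andP[xb' xn].
  rewrite IHk ?sub_le //.
  case/and3P=> pt t0 /eqP st -> /=.
  by rewrite xb' pt inE negb_or eq_sym -lt0n x_gt0 t0 /= st subnKC.
case: s => [|x s] /=; first by rewrite eq_sym (negPf n0).
case/and3P=> /andP[xb ps]; rewrite inE negb_or eq_sym -lt0n => /andP[x0 s0] /eqP sn.
have xn : x <= n by rewrite -sn leq_addr.
exists x, s; split=> //.
  by rewrite mem_iota add1n ltnS leq_min x0 xb.
rewrite IHk ?sub_le //.
by rewrite ps s0 -sn addKn /=.
Qed.

Lemma enum_intpart_uniq k b n : uniq (enum_intpart k b n).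
Proof.
elim: k b n => [|k IHk] b n /=; case: ifP => // _.
apply: allpairs_uniq_dep => //; first exact: iota_uniq.
by move=> [x s] [y t] _ _ /= [-> ->].
Qed.

Lemma enum_intpartE N s :
  (s \in enum_intpart N N N) = is_intpart N s.
Proof.
rewrite mem_enum_intpart // /is_intpart; case: s => [|x s] //=.
case: eqP => [<-|]; last by rewrite !andbF.
by rewrite leq_addr.
Qed.

Definition intpart_enum N : seq (intpart N) :=
  pmap insub (enum_intpart N N N).

Lemma intpart_enum_uniq N : uniq (intpart_enum N).
Proof. exact: pmap_sub_uniq (enum_intpart_uniq N N N). Qed.

Lemma mem_intpart_enum N (la : intpart N) : la \in intpart_enum N.
Proof. by rewrite mem_pmap_sub enum_intpartE; exact: intpartP. Qed.

HB.instance Definition _ N :=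
  isFinite.Build (intpart N)
    (Finite.uniq_enumP (@intpart_enum_uniq N) (@mem_intpart_enum N)).

Local Open Scope ring_scope.

(* The parts are listed in weakly decreasing order: [head] is the largest part,
   [last] the smallest one. *)
Definition largest (s : seq nat) : nat := head 0%N s.
Definition smallest (s : seq nat) : nat := last 0%N s.

Definition spt (N : nat) : nat :=
  (\sum_(la : intpart N) count_mem (smallest la) la)%N.

Definition rank (s : seq nat) : int := (largest s)%:Z - (size s)%:Z.

Definition ones (s : seq nat) : nat := count_mem 1%N s.
Definition mu (s : seq nat) : nat := count (fun x => (ones s < x)%N) s.

Definition crank (s : seq nat) : int :=
  if ones s == 0%N then (largest s)%:Z else (mu s)%:Z - (ones s)%:Z.

Definition rank_count (m : int) (N : nat) : int :=
  #|[set la : intpart N | rank la == m]|%:Z.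

Definition crank_count (m : int) (N : nat) : int :=
  if N == 1%N then
    if m == 0 then -1 else if (m == 1) || (m == -1) then 1 else 0
  else #|[set la : intpart N | crank la == m]|%:Z.

(* The sums over all m >= 1 are cut at m = N; by [rank_count_eq0] and
   [crank_count_eq0] the omitted terms vanish. *)
Definition rank_moment (r N : nat) : int :=
  \sum_(1 <= m < N.+1) m%:Z ^+ r * rank_count m%:Z N.

Definition crank_moment (r N : nat) : int :=
  \sum_(1 <= m < N.+1) m%:Z ^+ r * crank_count m%:Z N.

Definition ospt (N : nat) : int := crank_moment 1 N - rank_moment 1 N.

Lemma largest_le N (la : intpart N) : (largest la <= N)%N.
Proof.
case/and3P: (intpartP la) => _ _ /eqP; rewrite /largest.
by case: (parts la) => //= x s <-; exact: leq_addr.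
Qed.

Lemma mu_le_sumn (s : seq nat) : (mu s <= sumn s)%N.
Proof.
rewrite /mu; elim: s (ones s) => //= x s IHs c.
by apply: leq_add => //; case: x => [|x]; case: ltnP.
Qed.

Lemma rank_le N (la : intpart N) : rank la <= N%:Z.
Proof.
rewrite /rank lerBlDr -PoszD lez_nat.
by apply: leq_trans (largest_le la) _; exact: leq_addr.
Qed.

Lemma crank_le N (la : intpart N) : crank la <= N%:Z.
Proof.
rewrite /crank; case: ifP => _; first by rewrite lez_nat largest_le.
rewrite lerBlDr -PoszD lez_nat.
case/and3P: (intpartP la) => _ _ /eqP sN.
by apply: leq_trans (mu_le_sumn la) _; rewrite sN leq_addr.
Qed.

Lemma rank_count_eq0 (m N : nat) : (N < m)%N -> rank_count m%:Z N = 0.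
Proof.
move=> ltNm; rewrite /rank_count; apply/eqP; rewrite eqz_nat cards_eq0.
apply/eqP/setP => la; rewrite !inE; apply/negbTE/eqP => E.
by have := rank_le la; rewrite E lez_nat leqNgt ltNm.
Qed.

Lemma crank_count_eq0 (m N : nat) :
  (0 < N)%N -> (N < m)%N -> crank_count m%:Z N = 0.
Proof.
move=> N_gt0 ltNm; rewrite /crank_count; case: eqP => [N1|_].
  by move: ltNm; rewrite N1; case: m => [|[|m]].
apply/eqP; rewrite eqz_nat cards_eq0.
apply/eqP/setP => la; rewrite !inE; apply/negbTE/eqP => E.
by have := crank_le la; rewrite E lez_nat leqNgt ltNm.
Qed.

(* Main.v *)
(* Let C_s(N) and G_s(N) count the partitions of N of crank >= s and of rank
   >= s.  Since ospt(N) is the sum over s >= 1 of C_s(N) - G_s(N), it is enough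
   to prove Andrews' identity in the form
     spt(N) = \sum_(s >= 1) (2s-1) (C_s(N) - G_s(N)).
   As power series in q, with P the series of all partitions, Dyson's map gives
   G_s = q^(s+1) (P - G_(s+3)), and a similar map gives C_s = q^s (P - C_(s+1)).
   Hence C_s - G_s is P times the sum over j >= 1 of
     (-1)^(j-1) q^(j(j-1)/2) (1 - q^(j^2)) q^(js),
   and the series of spt is P times the sum of q^n (q)_(n-1) / (1 - q^n).
   The identity between the two is the limit m -> oo of
     \sum_(1 <= n <= m) q^n (q)_(n-1) / (1 - q^n)
       = \sum_(1 <= r <= m) (-1)^(r-1) q^(r(r+1)/2) (1 - q^(r^2)) (1 + q^r)
           / (1 - q^r)^2 * (q)_m^2 / ((q)_(m-r) (q)_(m+r)),
   proved by induction on m from the Bailey pair relations for the sequences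
   delta_(m,0) and 1 / (q)_m. *)

Require Import Defs.
From mathcomp Require Import all_boot all_order all_algebra.
From mathcomp Require Import ring zify.
Set Implicit Arguments.
Unset Strict Implicit.
Unset Printing Implicit Defensive.
Import Order.TTheory GRing.Theory Num.Theory.

Local Open Scope ring_scope.

(** * The finite identity and its limit *)

Section QSeries.

Variables (A : comNzRingType) (q : A) (v : nat -> A).
Hypothesis vK : forall n, (0 < n)%N -> (1 - q ^+ n) * v n = 1.

(** Multiplication by [v n] inverts it. Denominators are cleared through this injectivity, since [A]
    need not be a domain and [q] is nilpotent later on. *)
Lemma subX_inj n : (0 < n)%N -> injective ( *%R (1 - q ^+ n)).
Proof.
move=> n_gt0; apply: (can_inj (g := *%R (v n))) => x.
by rewrite mulrCA mulrA vK ?mul1r.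
Qed.

Definition qfact n := \prod_(i < n) (1 - q ^+ i.+1).
Definition qfactV n := \prod_(i < n) v i.+1.

Lemma qfactS n : qfact n.+1 = qfact n * (1 - q ^+ n.+1).
Proof. by rewrite /qfact big_ord_recr. Qed.

Lemma qfactVS n : qfactV n.+1 = qfactV n * v n.+1.
Proof. by rewrite /qfactV big_ord_recr. Qed.

Lemma qfactK n : qfact n * qfactV n = 1.
Proof.
elim: n => [|n IHn]; first by rewrite /qfact /qfactV !big_ord0 mulr1.
by rewrite qfactS qfactVS mulrACA IHn vK ?mulr1.
Qed.

Lemma qfactVSK n : (1 - q ^+ n.+1) * qfactV n.+1 = qfactV n.
Proof. by rewrite qfactVS mulrCA vK ?mulr1. Qed.

(** The kernel [1 / ((q)_(n-r) (q)_(n+r))] of Bailey pairs relative to 1. The guard makes it vanish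
    for [r > n], where truncated subtraction would not. *)
Definition bailey n r :=
  if (r <= n)%N then qfactV (n - r) * qfactV (n + r) else 0.

Lemma bailey_stepn n r : (r <= n.+1)%N ->
  (1 - q ^+ (n.+1 - r)) * (1 - q ^+ (n.+1 + r)) * bailey n.+1 r = bailey n r.
Proof.
rewrite /bailey => ler; rewrite ler; case: leqP => [lern|ltnr].
  by rewrite subSn // addSn mulrACA !qfactVSK.
have -> : r = n.+1 by apply/eqP; rewrite eqn_leq ler.
by rewrite subnn expr0 subrr !mul0r.
Qed.

Lemma bailey_stepr n r : (r < n)%N ->
  (1 - q ^+ (n - r)) * bailey n r = (1 - q ^+ (n + r.+1)) * bailey n r.+1.
Proof.
move=> ltrn; rewrite /bailey ltrn ltnW // mulrA [RHS]mulrCA.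
by rewrite addnS qfactVSK -(subnSK ltrn) qfactVSK.
Qed.

Lemma bailey0 n : bailey n 0 = qfactV n ^+ 2.
Proof. by rewrite /bailey subn0 addn0 expr2. Qed.

(* The telescoping functions [g] in this proof and the next one are q-WZ
   certificates for the recurrences in [n]. *)
Lemma bailey_unit_sum n : (0 < n)%N ->
  \sum_(1 <= r < n.+1) (- 1) ^+ r * q ^+ 'C(r, 2) * (1 + q ^+ r) * bailey n r
  = - qfactV n ^+ 2.
Proof.
move=> n_gt0; apply: (subX_inj n_gt0); rewrite mulr_sumr.
pose g r := (- 1) ^+ r * q ^+ ('C(r, 2) + r) *
  ((1 - q ^+ (n - r)) * bailey n r).
rewrite big_add1 /= (telescope_sumr_eq g) //; last first.
  move=> r /andP[_ ltrn]; rewrite /g (bailey_stepr ltrn) binS bin1.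
  set d := (n - r.+1)%N; have -> : n = (d + r.+1)%N by rewrite subnK.
  by rewrite !exprD !exprS; ring.
rewrite /g subnn expr0 subrr mul0r mulr0 sub0r subn0 bailey0 mulrN.
by rewrite !expr0 !mul1r.
Qed.

(** A finite form of Euler's pentagonal number theorem: the exponent is [r(3r-1)/2], and multiplying
    by [(q)_n^2] and letting [n] grow gives the classical statement. *)
Lemma bailey_pentagonal_sum n :
  qfactV n ^+ 2 + \sum_(1 <= r < n.+1)
    (- 1) ^+ r * q ^+ ('C(r, 2) + r ^ 2) * (1 + q ^+ r) * bailey n r
  = qfactV n.
Proof.
elim: n => [|n IHn].
  by rewrite big_geq // addr0 /qfactV big_ord0 expr1n.
apply: (subX_inj (ltn0Sn n)); rewrite qfactVSK.
pose g r := (- 1) ^+ r * q ^+ (n.+1 + r.*2 + 'C(r, 2) + r ^ 2) *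
  ((1 - q ^+ (n.+1 - r)) * bailey n.+1 r).
pose u m r := (- 1) ^+ r * q ^+ ('C(r, 2) + r ^ 2) * (1 + q ^+ r) * bailey m r.
have gE r : (r < n.+1)%N ->
    (1 - q ^+ n.+1) * u n.+1 r.+1 = u n r.+1 + (g r.+1 - g r).
  move=> ltrn; rewrite /u /g (bailey_stepr ltrn) -(bailey_stepn ltrn) binS bin1.
  set d := (n.+1 - r.+1)%N; have -> : n.+1 = (d + r.+1)%N by rewrite subnK.
  have -> : (r.+1 ^ 2 = r ^ 2 + r.*2 + 1)%N by lia.
  by rewrite doubleS -addnn !(exprD, exprS) expr0; ring.
rewrite -[RHS]IHn mulrDr mulr_sumr !big_add1 /=.
rewrite (eq_big_nat _ _ (F2 := fun r => u n r.+1 + (g r.+1 - g r))); last first.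
  by move=> r /andP[_ ltrn]; apply: gE.
rewrite big_split /= telescope_sumr // big_nat_recr //= /u /bailey ltnn mulr0.
rewrite addr0 addrCA addrC; congr (_ + _).
(* [g n.+1] vanishes, and [- g 0] turns the factor [1 - q^(n+1)] of the isolated term into its
   square. *)
rewrite /g subnn expr0 subrr mul0r mulr0 sub0r subn0 bailey0.
rewrite double0 !addn0 expr0 mul1r -(qfactVSK n).
ring.
Qed.

Definition spt_term r :=
  (- 1) ^+ r.-1 * q ^+ ('C(r, 2) + r) * (1 - q ^+ (r ^ 2)) *
  (1 + q ^+ r) * v r ^+ 2.

Lemma finite_spt_identity n :
  \sum_(1 <= k < n.+1) q ^+ k * qfact k.-1 * v k
  = \sum_(1 <= r < n.+1) spt_term r * (qfact n ^+ 2 * bailey n r).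
Proof.
elim: n => [|n IHn]; first by rewrite !big_geq.
rewrite big_nat_recr //= IHn; apply/eqP; rewrite -subr_eq0 -opprB oppr_eq0.
rewrite opprD addrA subr_eq0; apply/eqP.
have -> : \sum_(1 <= r < n.+1) spt_term r * (qfact n ^+ 2 * bailey n r) =
          \sum_(1 <= r < n.+2) spt_term r * (qfact n ^+ 2 * bailey n r).
  by rewrite [in RHS]big_nat_recr //= /bailey ltnn !mulr0 addr0.
rewrite -sumrB.
(* With [Q = q^(n+1)], [(1 - Q)^2 - (1 - Q q^(-r)) (1 - Q q^r) = Q q^(-r) (1 - q^r)^2]; the last
   square cancels [v r ^+ 2], and [q^(-r)] is absorbed by the exponent in [spt_term]. *)
transitivity (\sum_(1 <= r < n.+2) q ^+ n.+1 * qfact n ^+ 2 *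
  ((- 1) ^+ r * q ^+ ('C(r, 2) + r ^ 2) * (1 + q ^+ r) * bailey n.+1 r -
   (- 1) ^+ r * q ^+ 'C(r, 2) * (1 + q ^+ r) * bailey n.+1 r)).
  apply: eq_big_nat => -[|r] // /andP[_ ltrn].
  rewrite qfactS -(@bailey_stepn n r.+1 ltrn) /spt_term /=.
  set d := (n.+1 - r.+1)%N; have -> : n.+1 = (d + r.+1)%N by rewrite subnK.
  rewrite -[RHS]mulr1 [X in _ = _ * X](_ : 1 = ((1 - q ^+ r.+1) * v r.+1) ^+ 2).
    by rewrite !(exprD, exprS); ring.
  by rewrite vK ?expr1n.
(* The two Bailey sums differ by [qfactV n.+1] alone, as the squares cancel. *)
rewrite -mulr_sumr sumrB bailey_unit_sum //.
have /(canRL (addKr _)) -> := bailey_pentagonal_sum n.+1.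
rewrite opprK addrAC addNr add0r qfactVS.
rewrite [RHS](_ : _ = q ^+ n.+1 * qfact n * (qfact n * qfactV n) * v n.+1).
  by ring.
by rewrite qfactK mulr1.
Qed.

(** * Passing to the limit: power series truncated after degree [K] *)

Variable K : nat.
Hypothesis qX_eq0 : q ^+ K.+1 = 0.

Lemma trunc_eq0 n : (K < n)%N -> q ^+ n = 0.
Proof. by move/subnK <-; rewrite exprD qX_eq0 mulr0. Qed.

Lemma qfactV_const n : (K <= n)%N -> qfactV n = qfactV K.
Proof.
elim: n => [|n IHn]; first by rewrite leqn0 => /eqP->.
rewrite leq_eqVlt => /predU1P[->//|leKn]; rewrite qfactVS IHn //.
by rewrite -[v _]mul1r -{1}[1](subr0 1) -(@trunc_eq0 n.+1) ?vK ?mulr1.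
Qed.

(** All three [q]-factorials have stabilized once their index reaches [K], so the limit 1 of this
    quotient is attained. *)
Lemma qfact_bailey n r : (K + r <= n)%N -> qfact n ^+ 2 * bailey n r = 1.
Proof.
move=> le_n; rewrite /bailey ifT; last by lia.
rewrite (@qfactV_const (n - r)) ?(@qfactV_const (n + r)); try lia.
by rewrite -(@qfactV_const n) -?expr2 -?exprMn ?qfactK ?expr1n //; lia.
Qed.

(** The series [x (1 + x) / (1 - x)^2] of the odd numbers at [x = q^j]; it produces the denominators
    of [spt_term]. *)
Lemma sum_odd_geometric M j : (K <= M)%N -> (0 < j)%N ->
  \sum_(1 <= s < M.+1) (s.*2.-1)%:R * q ^+ (j * s)
  = q ^+ j * (1 + q ^+ j) * v j ^+ 2.
Proof.
move=> leKM j_gt0; apply: (subX_inj j_gt0); apply: (subX_inj j_gt0).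
rewrite [RHS](_ : _ = ((1 - q ^+ j) * v j) ^+ 2 * (q ^+ j * (1 + q ^+ j)));
  last by ring.
rewrite vK // expr1n mul1r.
(* The exact partial sum; its remainder carries [q^(j(m+1))], which is 0 at [m = M >= K]. *)
suff E m : (1 - q ^+ j) * ((1 - q ^+ j) *
    (\sum_(1 <= s < m.+1) (s.*2.-1)%:R * q ^+ (j * s))) =
  q ^+ j * (1 + q ^+ j) -
  q ^+ (j * m.+1) * ((m.*2.+1)%:R + q ^+ j - (m.*2)%:R * q ^+ j).
  rewrite E (@trunc_eq0 (j * M.+1)) ?mul0r ?subr0 //.
  by rewrite (leq_trans _ (leq_pmull _ j_gt0)).
elim: m => [|m IHm]; first by rewrite big_geq // muln1 double0; ring.
rewrite big_nat_recr // 2!(mulrDr (1 - q ^+ j)) IHm.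
have -> : (m.+1.*2.-1 = m + m + 1)%N by lia.
have -> : (m.+1.*2.+1 = m + m + 3)%N by lia.
have -> : (m.+1.*2 = m + m + 2)%N by lia.
have -> : (m.*2.+1 = m + m + 1)%N by lia.
rewrite -addnn !mulnS !exprD !natrD; ring.
Qed.

(** Used with [(a, b) = (1, 3)] for ranks and [(0, 1)] for cranks. Unfolding number [i], from 0,
    contributes [s + a + b i] to the exponent, whence the binomial. *)
Lemma iterate_shift_recurrence (a b : nat) (P : A) (X : nat -> A) :
  (forall s, (0 < s)%N -> X s = q ^+ (s + a) * (P - X (s + b)%N)) ->
  forall J s, (0 < s)%N ->
  X s = P * \sum_(1 <= j < J.+1)
              (- 1) ^+ j.-1 * q ^+ (b * 'C(j, 2) + j * (s + a))
    + (- 1) ^+ J * q ^+ (b * 'C(J, 2) + J * (s + a)) * X (s + b * J)%N.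
Proof.
move=> XE J s s_gt0; elim: J => [|J IHJ].
  by rewrite big_geq // mulr0 add0r !muln0 addn0 expr0 !mul1r.
rewrite {1}IHJ XE; last by lia.
rewrite [in RHS]big_nat_recr //= binS bin1 !mulnDr mulSn mulnS.
rewrite (_ : s + b * J + b = s + (b + b * J))%N; last by lia.
by rewrite !(mulnDr, exprD, exprS); ring.
Qed.

Lemma shift_recurrence_sol (a b : nat) (P : A) (X : nat -> A) M :
  (forall s, (0 < s)%N -> X s = q ^+ (s + a) * (P - X (s + b)%N)) ->
  (K < M)%N -> forall s, (0 < s)%N ->
  X s = P * \sum_(1 <= j < M.+1)
              (- 1) ^+ j.-1 * q ^+ (b * 'C(j, 2) + j * (s + a)).
Proof.
move=> XE ltKM s s_gt0; rewrite {1}(iterate_shift_recurrence XE M s_gt0).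
rewrite [X in _ * X * _]trunc_eq0 ?mulr0 ?mul0r ?addr0 //.
by rewrite mulnDr addnCA (leq_trans ltKM) // (leq_trans (leq_pmulr _ s_gt0))
  ?leq_addr.
Qed.

(** [P n] stands for the series of partitions with all parts at least [n], [Z n] for the appearances
    of [n] as smallest part, [G] and [C] for the rank and crank counts. The first two recurrences
    give [P n = (q)_(n-1) P 1] and [Z n = q^n P n / (1 - q^n)]. *)
Lemma andrews_spt_identity (P Z G C : nat -> A) M :
  (forall n, (0 < n)%N -> P n = P n.+1 + q ^+ n * P n) ->
  (forall n, (0 < n)%N -> Z n = q ^+ n * (Z n + P n)) ->
  (forall s, (0 < s)%N -> G s = q ^+ (s + 1) * (P 1 - G (s + 3)%N)) ->
  (forall s, (0 < s)%N -> C s = q ^+ s * (P 1 - C (s + 1)%N)) ->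
  (K.*2 < M)%N ->
  \sum_(1 <= n < M.+1) Z n
  = \sum_(1 <= s < M.+1) (s.*2.-1)%:R * (C s - G s).
Proof.
move=> PE ZE GE CE ltKM.
have leKM : (K < M)%N by lia.
have PqE n : P n.+1 = qfact n * P 1%N.
  elim: n => [|n IHn]; first by rewrite /qfact big_ord0 mul1r.
  apply/eqP; rewrite qfactS mulrAC -IHn mulrBr mulr1 [P n.+1 * _]mulrC.
  by rewrite eq_sym subr_eq -PE.
transitivity (P 1%N * \sum_(1 <= n < M.+1) q ^+ n * qfact n.-1 * v n).
  rewrite mulr_sumr; apply: eq_big_nat => -[|n] // _ /=.
  apply: (@subX_inj n.+1) => //; rewrite mulrBl mul1r {1}ZE // mulrDr.
  rewrite addrAC subrr add0r PqE -[LHS]mulr1 -[X in _ * X = _](@vK n.+1) //;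
    ring.
rewrite finite_spt_identity.
transitivity (P 1%N * \sum_(1 <= j < M.+1) spt_term j).
  congr (_ * _); apply: eq_big_nat => j /andP[j_gt0 _].
  (* Stabilization needs [K + j <= M], hence the bound [2K < M]; beyond [K] the power of [q] in
     [spt_term] is 0. *)
  have [lejK|ltKj] := leqP j K; first by rewrite qfact_bailey ?mulr1 //; lia.
  by rewrite /spt_term (@trunc_eq0 ('C(j, 2) + j)) ?mulr0 ?mul0r // ltn_addl.
have CE' s : (0 < s)%N -> C s = q ^+ (s + 0) * (P 1 - C (s + 1)%N).
  by rewrite addn0; exact: CE.
transitivity (\sum_(1 <= s < M.+1) \sum_(1 <= j < M.+1) P 1%N *
   ((- 1) ^+ j.-1 * q ^+ 'C(j, 2) * (1 - q ^+ (j ^ 2)) *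
    ((s.*2.-1)%:R * q ^+ (j * s)))).
  rewrite exchange_big mulr_sumr; apply: eq_big_nat => j /andP[j_gt0 _] /=.
  rewrite -mulr_sumr -mulr_sumr sum_odd_geometric //; last by lia.
  rewrite /spt_term exprD; ring.
apply: eq_big_nat => s /andP[s_gt0 _].
rewrite (shift_recurrence_sol GE leKM) // (shift_recurrence_sol CE' leKM) //.
rewrite -mulrBr -sumrB mulrCA -mulr_sumr; congr (_ * _).
rewrite mulr_sumr; apply: eq_big_nat => j _.
(* The rank exponent exceeds the crank exponent by [j^2], which yields the factor [1 - q^(j^2)]. *)
have -> : (3 * 'C(j, 2) + j * (s + 1) = 'C(j, 2) + j ^ 2 + j * s)%N.
  have : ('C(j, 2) * 2 + j = j ^ 2)%N.
    by elim: j => // j; rewrite binS bin1; lia.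
  by lia.
by rewrite mul1n addn0 !exprD; ring.
Qed.

End QSeries.

Local Close Scope ring_scope.

(** * Partitions as lists *)

Section Reindexing.

Variables (T1 T2 : eqType) (s1 : seq T1) (s2 : seq T2).
Variables (Q1 : pred T1) (Q2 : pred T2) (f : T1 -> T2) (g : T2 -> T1).
Hypotheses (us1 : uniq s1) (us2 : uniq s2).
Hypothesis fP : forall x, x \in s1 -> Q1 x ->
  [/\ f x \in s2, Q2 (f x) & g (f x) = x].
Hypothesis gP : forall y, y \in s2 -> Q2 y ->
  [/\ g y \in s1, Q1 (g y) & f (g y) = y].

Lemma sum_bij (F : T2 -> nat) :
  \sum_(y <- s2 | Q2 y) F y = \sum_(x <- s1 | Q1 x) F (f x).
Proof.
rewrite -[LHS]big_filter -[RHS]big_filter -[RHS](big_map f predT).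
apply: perm_big; apply: uniq_perm; first exact: filter_uniq.
  rewrite map_inj_in_uniq ?filter_uniq // => x y.
  rewrite !mem_filter => /andP[Qx xs] /andP[Qy ys] eq_f.
  by case: (fP xs Qx) (fP ys Qy) => _ _ gx [_ _ gy]; rewrite -gx eq_f gy.
move=> y; rewrite mem_filter; apply/andP/mapP => [[Qy ys]|[x]].
  by case: (gP ys Qy) => gs Qg <-; exists (g y); rewrite ?mem_filter ?Qg.
by rewrite mem_filter => /andP[Qx xs] ->; case: (fP xs Qx).
Qed.

Lemma count_bij : count Q1 s1 = count Q2 s2.
Proof. by rewrite -!sum1_count (sum_bij (fun=> 1)). Qed.

End Reindexing.

Definition partitions N := enum_intpart N N N.
Definition npart (Q : pred (seq nat)) N := count Q (partitions N).

Lemma mem_partitions N s : (s \in partitions N) = is_intpart N s.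
Proof. exact: enum_intpartE. Qed.

Lemma uniq_partitions N : uniq (partitions N).
Proof. exact: enum_intpart_uniq. Qed.

Lemma sum_intpart N (F : seq nat -> nat) :
  \sum_(la : intpart N) F la = \sum_(s <- partitions N) F s.
Proof.
rewrite -(big_map (@parts N) predT F); apply: perm_big; apply: uniq_perm.
- by rewrite map_inj_uniq ?index_enum_uniq //; exact: val_inj.
- exact: uniq_partitions.
move=> s; rewrite mem_partitions; apply/mapP/idP => [[la _ ->]|sN].
  exact: intpartP.
by exists (IntPart sN); rewrite ?mem_index_enum.
Qed.

Lemma card_intpart N (Q : pred (seq nat)) :
  #|[set la : intpart N | Q la]| = npart Q N.
Proof.
rewrite -sum1_card (eq_bigl (fun la : intpart N => Q la)); last first.
  by move=> la; rewrite inE.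
rewrite big_mkcond (sum_intpart N (fun s => if Q s then 1 else 0)) -big_mkcond.
by rewrite sum1_count.
Qed.

Lemma eq_npart N (Q1 Q2 : pred (seq nat)) :
  (forall s, is_intpart N s -> Q1 s = Q2 s) -> npart Q1 N = npart Q2 N.
Proof.
by move=> eqQ; apply: eq_in_count => s; rewrite mem_partitions; exact: eqQ.
Qed.

Lemma npart_eq0 N (Q : pred (seq nat)) :
  (forall s, is_intpart N s -> ~~ Q s) -> npart Q N = 0.
Proof.
move=> nQ; rewrite (@eq_npart N Q pred0) /npart ?count_pred0 //.
by move=> s /nQ/negbTE.
Qed.

Lemma npart_split N (Q1 Q : pred (seq nat)) :
  npart Q N
  = npart (fun s => Q1 s && Q s) N + npart (fun s => ~~ Q1 s && Q s) N.
Proof.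
rewrite /npart -[LHS]size_filter -(count_predC Q1) !count_filter.
by congr (_ + _); apply: eq_count => s.
Qed.

Lemma npart_bij N M (Q1 Q2 : pred (seq nat)) (f g : seq nat -> seq nat) :
  (forall s, is_intpart N s -> Q1 s ->
    [/\ is_intpart M (f s), Q2 (f s) & g (f s) = s]) ->
  (forall s, is_intpart M s -> Q2 s ->
    [/\ is_intpart N (g s), Q1 (g s) & f (g s) = s]) ->
  npart Q1 N = npart Q2 M.
Proof.
move=> fP gP; apply: (@count_bij _ _ _ _ _ _ f g);
  rewrite ?uniq_partitions // => s;
  rewrite !mem_partitions; [exact: fP | exact: gP].
Qed.

Lemma mem_pos (s : seq nat) x : 0 \notin s -> x \in s -> 0 < x.
Proof. by move=> s0 xs; rewrite lt0n; apply: contraNneq s0 => <-. Qed.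

Lemma filter_pos (s : seq nat) : 0 \notin s -> [seq x <- s | 0 < x] = s.
Proof. by move=> s0; apply/all_filterP/allP => x; exact: mem_pos. Qed.

Lemma geqn_trans : transitive geq.
Proof. by move=> x y z /= xy zx; apply: leq_trans zx xy. Qed.

Lemma geq_pairwise s : sorted geq s = pairwise geq s.
Proof. exact: sorted_pairwise geqn_trans _. Qed.

Lemma intpart_rcons N s n : 0 < n ->
  is_intpart (N + n) (rcons s n) = all (leq n) s && is_intpart N s.
Proof.
move=> n_gt0; rewrite /is_intpart !geq_pairwise pairwise_rcons mem_rcons inE.
rewrite sumn_rcons eqn_add2r negb_or eq_sym -lt0n n_gt0 /=.
by rewrite -!andbA.
Qed.

Lemma intpart_rconsK N s n : all (leq n) s -> n \in s -> is_intpart N s ->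
  s = rcons (take (size s).-1 s) n.
Proof.
move=> sn ns /and3P[so _ _]; case/lastP: s => // s m in sn ns so *.
rewrite size_rcons /= -cats1 take_size_cat // cats1; congr rcons.
move: so sn ns; rewrite geq_pairwise pairwise_rcons all_rcons mem_rcons inE.
move=> /andP[/allP sm _] /andP[nm _] /predU1P[//|ns].
by apply/eqP; rewrite eqn_leq nm; have /= -> := sm n ns.
Qed.

Lemma sum_rcons N n (F : seq nat -> nat) : 0 < n ->
  \sum_(s <- partitions (N + n) | all (leq n) s && (n \in s)) F s
  = \sum_(s <- partitions N | all (leq n) s) F (rcons s n).
Proof.
move=> n_gt0.
apply: (@sum_bij _ _ _ _ _ _ _ (fun s => take (size s).-1 s));
  rewrite ?uniq_partitions // => s; rewrite !mem_partitions.
  move=> sN sn; rewrite intpart_rcons // sn sN all_rcons sn leqnn mem_rcons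
    mem_head.
  by rewrite size_rcons /= -cats1 take_size_cat.
move=> sN /andP[sn ns].
have sE := intpart_rconsK sn ns sN; rewrite -sE; move: sN; rewrite {1}sE.
by rewrite intpart_rcons // => /andP[-> ->].
Qed.

Lemma npart_sum N (Q : pred (seq nat)) :
  npart Q N = \sum_(s <- partitions N) Q s.
Proof.
rewrite /npart -sum1_count big_mkcond.
by apply: eq_bigr => s _; case: (Q s).
Qed.

Lemma npart_rcons N n (Q : pred (seq nat)) : 0 < n ->
  npart (fun s => [&& all (leq n) s, n \in s & Q s]) (N + n)
  = npart (fun s => all (leq n) s && Q (rcons s n)) N.
Proof.
move=> n_gt0; rewrite /npart -!sum1_count.
under eq_bigl => s do rewrite andbA.
rewrite big_mkcondr [RHS]big_mkcondr.
exact: (@sum_rcons N n (fun s => if Q s then 1 else 0)).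
Qed.

Lemma all_leq1_intpart N s : is_intpart N s -> all (leq 1) s.
Proof. by case/and3P=> _ s0 _; apply/allP => x; exact: mem_pos. Qed.

Lemma npart_rcons1 N (Q : pred (seq nat)) :
  npart (fun s => (1 \in s) && Q s) N.+1 = npart (fun s => Q (rcons s 1)) N.
Proof.
transitivity (npart (fun s => [&& all (leq 1) s, 1 \in s & Q s]) (N + 1)).
  by rewrite addn1; apply: eq_npart => s /all_leq1_intpart ->.
by rewrite npart_rcons //; apply: eq_npart => s /all_leq1_intpart ->.
Qed.

Lemma npart_noones N (Q : pred (seq nat)) :
  npart (fun s => (1 \notin s) && Q s) N.+1 + npart (fun s => Q (rcons s 1)) N
  = npart Q N.+1.
Proof.
by rewrite (npart_split N.+1 (fun s => 1 \in s) Q) npart_rcons1 addnC.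
Qed.

(** The coefficients of [q^n] times the series with coefficients [a]. *)
Definition shift n (a : nat -> nat) N := if n <= N then a (N - n) else 0.

(** Either [n] does not occur, or one copy of it, necessarily a last part, can be deleted. *)
Lemma npart_ge_rec n N : 0 < n ->
  npart (all (leq n)) N
  = npart (all (leq n.+1)) N + shift n (npart (all (leq n))) N.
Proof.
move=> n_gt0; rewrite (npart_split N (fun s => n \notin s)); congr (_ + _).
  apply: eq_npart => s _; elim: s => //= x s <-.
  rewrite inE negb_or [n < x]ltn_neqAle.
  by case: (n == x); case: (n \in s); case: (n <= x); case: all.
rewrite /shift; case: leqP => [leN|ltN].
  rewrite -{1}(subnK leN).
  rewrite -[RHS](@eq_npart _ (fun s => all (leq n) s && predT (rcons s n))).
    rewrite -npart_rcons //; apply: eq_npart => s _.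
    by rewrite negbK andbT andbC.
  by move=> s _; rewrite andbT.
apply: npart_eq0 => s /and3P[_ _ /eqP sN].
apply/negP => /andP[/negPn ns _].
by move: ltN; rewrite ltnNge -sN sumnE (big_rem _ ns) leq_addr.
Qed.

(** Partitions without the part [n] contribute 0, so only those with smallest part [n] count. *)
Definition spt_with_smallest n N :=
  \sum_(s <- partitions N | all (leq n) s) count_mem n s.

(** Deleting one copy of [n] lowers its multiplicity by one; the second term restores this unit. *)
Lemma spt_with_smallest_rec n N : 0 < n ->
  spt_with_smallest n N
  = shift n (spt_with_smallest n) N + shift n (npart (all (leq n))) N.
Proof.
move=> n_gt0; rewrite /shift /spt_with_smallest (bigID (fun s => n \in s)) /=.
rewrite [X in _ + X]big1 ?addn0; last by move=> s /andP[_ /count_memPn].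
case: leqP => [leN|ltN].
  rewrite -{1}(subnK leN) sum_rcons //;
    under eq_bigr do rewrite -cats1 count_cat /= eqxx addn0.
  by rewrite big_split /= sum1_count.
rewrite big_seq_cond big1 // => s;
  rewrite mem_partitions => /andP[/and3P[_ _ /eqP sN] /andP[_ ns]].
by move: ltN; rewrite ltnNge -sN sumnE (big_rem _ ns) leq_addr.
Qed.

Lemma last_min n s : sorted geq s -> s != [::] ->
  all (leq n) s = (n <= last 0 s).
Proof.
case/lastP: s => // s m;
  rewrite geq_pairwise pairwise_rcons last_rcons all_rcons.
move=> /andP[/allP sm _] _; case: leqP => //= nm; apply/allP => x /sm.
exact: leq_trans nm.
Qed.

Lemma spt_sum_smallest N M : 0 < N <= M ->
  spt N = \sum_(1 <= n < M.+1) spt_with_smallest n N.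
Proof.
move=> /andP[N_gt0 leNM];
  rewrite /spt (sum_intpart N (fun s => count_mem (smallest s) s)).
rewrite /spt_with_smallest; under [RHS]eq_bigr do rewrite big_mkcond.
rewrite exchange_big /= big_seq [RHS]big_seq; apply: eq_bigr => s.
rewrite mem_partitions => sN; have /and3P[so s0 /eqP sumN] := sN.
have s_neq0 : s != [::].
  by apply: contraTneq N_gt0 => s_nil; rewrite -sumN s_nil.
have last_s : last 0 s \in s by case: (s) s_neq0 => // x t _; exact: mem_last.
have lastN : 0 < last 0 s < M.+1.
  rewrite lt0n ltnS (leq_trans _ leNM) -?sumN ?sumnE ?(big_rem _ last_s)
    ?leq_addr // andbT.
  by apply: contraNneq s0 => <-.
rewrite (bigD1_seq (last 0 s)) ?iota_uniq ?mem_index_iota //=.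
rewrite last_min // leqnn big1_seq ?addn0 // => n /andP[n_neq _].
case: ifP => // nlast; apply/count_memPn; apply: contra_neqN n_neq => ns.
apply/eqP; rewrite eqn_leq; move: nlast; rewrite last_min // => ->.
by have := last_min (last 0 s) so s_neq0; rewrite leqnn => /allP/(_ n ns).
Qed.

(** * Ranks and cranks *)

(** First columns of Young diagrams: dropping one erases the parts 1, and adding one of height
    [k >= size s] creates [k - size s] new parts 1. *)
Definition drop_column s := [seq x <- map predn s | 0 < x].
Definition add_column k s := map succn s ++ nseq (k - size s) 1.

Lemma drop_columnK s : sorted geq s -> 0 \notin s ->
  add_column (size s) (drop_column s) = s.
Proof.
rewrite /add_column /drop_column; elim: s => //= x s IHs so.
rewrite inE negb_or eq_sym -lt0n => /andP[x_gt0 s0].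
case: x x_gt0 so => // -[|x] _ so /=;
  last by rewrite subSS IHs // (path_sorted so).
have -> : s = nseq (size s) 1.
  move: so; rewrite path_sortedE; last exact: geqn_trans.
  case/andP=> /allP s1 _; apply/all_pred1P/allP => y ys /=.
  rewrite eqn_leq; have /= -> := s1 y ys; rewrite lt0n;
    apply: contraNneq s0 => <- //.
by rewrite map_nseq filter_nseq /= size_nseq.
Qed.

Lemma add_columnK k s : 0 \notin s -> drop_column (add_column k s) = s.
Proof.
move=> s0; rewrite /drop_column /add_column map_cat map_nseq filter_cat
  filter_nseq.
by rewrite cats0 -map_comp map_id; exact: filter_pos.
Qed.

Lemma size_drop_column s : size (drop_column s) <= size s.
Proof. by rewrite size_filter (leq_trans (count_size _ _)) ?size_map. Qed.

Lemma size_add_column k s : size s <= k -> size (add_column k s) = k.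
Proof. by move=> lek; rewrite size_cat size_map size_nseq subnKC. Qed.

Lemma sumn_add_column k s : size s <= k -> sumn (add_column k s) = sumn s + k.
Proof.
move=> lek; rewrite sumn_cat sumn_nseq mul1n.
rewrite (_ : sumn (map succn s) = sumn s + size s) -?addnA ?subnKC //.
by elim: s {lek} => //= x s ->; lia.
Qed.

Lemma intpart_add_column N k s : size s <= k -> is_intpart N s ->
  is_intpart (N + k) (add_column k s).
Proof.
move=> lek /and3P[so s0 /eqP sN]; apply/and3P; split;
  last by rewrite sumn_add_column ?sN.
  move: so; rewrite !geq_pairwise /add_column pairwise_cat pairwise_map =>
    -> /=.
  rewrite andbC /=; apply/andP; split.
    by elim: (_ - _) => //= m ->; rewrite all_nseq orbT.
  by apply/allrelP => x y /mapP[z _ ->] /nseqP[-> _].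
rewrite mem_cat negb_or mem_nseq andbF andbT.
by apply/mapP => -[].
Qed.

Lemma intpart_drop_column N s : is_intpart N s ->
  is_intpart (N - size s) (drop_column s).
Proof.
move=> sN; have /and3P[so s0 /eqP sumN] := sN; apply/and3P; split.
- rewrite geq_pairwise pairwise_filter // pairwise_map.
  move: so; rewrite geq_pairwise; apply: sub_pairwise => x y /=; lia.
- by rewrite mem_filter ltnn.
rewrite -sumN -{2}(drop_columnK so s0) sumn_add_column ?size_drop_column //.
by rewrite addnK.
Qed.

Lemma head_add_column k s : size s <= k ->
  head 0 (add_column k s) = if 0 < k then (head 0 s).+1 else 0.
Proof. by rewrite /add_column; case: s k => [|x s] [|k]. Qed.

Definition rank_ge r (s : seq nat) := size s + r <= largest s.

(* Dyson's map: delete the largest part [h] and add a column of length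
   [h - (r + 1)]. *)
Lemma rank_ge_rec r N : 0 < r ->
  npart (rank_ge r) N
  = shift r.+1 (npart (fun s => ~~ rank_ge (r + 3) s)) N.
Proof.
move=> r_gt0; rewrite /shift; case: (leqP r.+1 N) => [leN|ltN]; last first.
  apply: npart_eq0 => -[|x s]; rewrite /rank_ge; first by rewrite -ltnNge.
  by case/and3P=> _ _ /eqP /= sN; lia.
pose f s := add_column (head 0 s - r.+1) (behead s).
apply: (@npart_bij _ _ _ _ f (fun s => size s + r.+1 :: drop_column s)).
  case=> [|x s]; rewrite /rank_ge /f /=; first by lia.
  move=> xsN lex; have /and3P[/path_sorted so] := xsN.
  rewrite inE negb_or => /andP[_ s0] /eqP /= sN.
  have les : size s <= x - r.+1 by lia.
  have hs : head 0 s <= x by case: (s) xsN => //= y t /and3P[/andP[]].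
  rewrite size_add_column // add_columnK // subnK; last by lia.
  (* The new largest part is at most [x + 1] and there are [x - r.+1] parts, so the new rank is at
     most [r + 2]. *)
  split=> //; last by rewrite /largest head_add_column //; case: ifP; lia.
  rewrite (_ : N - r.+1 = sumn s + (x - r.+1)); last by lia.
  by apply: intpart_add_column; rewrite // /is_intpart so s0 eqxx.
move=> s sN; have /and3P[so s0 /eqP sumN] := sN;
  rewrite /rank_ge -ltnNge => lts.
rewrite /f /= addnK drop_columnK //; split=> //;
  last by have := size_drop_column s; lia.
have /and3P[dso ds0 /eqP dsN] := intpart_drop_column sN.
have size_le : size s <= N - r.+1.
  rewrite -sumN; elim: (s) s0 => //= x t IHt;
    rewrite inE negb_or => /andP[x0 /IHt]; lia.
apply/and3P; split=> /=; last by rewrite dsN; lia.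
  rewrite path_sortedE; last exact: geqn_trans.
  rewrite dso andbT; apply/allP => x;
    rewrite mem_filter => /andP[_ /mapP[y ys ->]] /=.
  have : y <= head 0 s.
    case: (s) so ys => //= z t; rewrite path_sortedE; last exact: geqn_trans.
    by move=> /andP[/allP zt _]; rewrite inE => /predU1P[->//|/zt].
  by move: lts; rewrite /largest; lia.
by rewrite inE negb_or ds0 andbT; lia.
Qed.

(** The conjugate partition: the parts become columns, the smallest being placed first. *)
Definition conj_part := foldr add_column [::].

Lemma conj_partP s : sorted geq s -> 0 \notin s ->
  [/\ is_intpart (sumn s) (conj_part s), size (conj_part s) = head 0 s
    & head 0 (conj_part s) = size s].
Proof.
elim: s => //= x s IHs so; rewrite inE negb_or eq_sym -lt0n => /andP[x_gt0 s0].
have [cP sz hd] := IHs (path_sorted so) s0.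
have lex : size (conj_part s) <= x.
  by rewrite sz; case: (s) so => //= y t /andP[].
rewrite addnC; split; first exact: intpart_add_column.
  exact: size_add_column.
by rewrite head_add_column // x_gt0 hd.
Qed.

Lemma conj_part_inj s t :
  sorted geq s -> 0 \notin s -> sorted geq t -> 0 \notin t ->
  conj_part s = conj_part t -> s = t.
Proof.
elim: s t => [|x s IHs] [|y t] //.
- by move=> _ _ ot nt; have [_ + _] := conj_partP ot nt => /[swap] <- /= y0;
  rewrite -y0 inE in nt.
- by move=> os ns _ _; have [_ + _] := conj_partP os ns => /[swap] -> /= y0;
  rewrite -y0 inE in ns.
move=> os ns ot nt eq_c.
have [_ szs _] := conj_partP os ns; have [_ szt _] := conj_partP ot nt.
move: szs; rewrite eq_c szt /= => eq_xy; rewrite eq_xy; congr cons.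
have [os' ns'] : sorted geq s /\ 0 \notin s.
  by move: ns; rewrite inE negb_or => /andP[_ ns]; split=> //;
    exact: path_sorted os.
have [ot' nt'] : sorted geq t /\ 0 \notin t.
  by move: nt; rewrite inE negb_or => /andP[_ nt]; split=> //;
    exact: path_sorted ot.
apply: IHs => //.
have [/and3P[_ cs _] _ _] := conj_partP os' ns';
  have [/and3P[_ ct _] _ _] := conj_partP ot' nt'.
by rewrite -(add_columnK x cs) -(add_columnK y ct); congr drop_column.
Qed.

(** Conjugation is injective and exchanges the number of parts with the largest part, which gives
    both inequalities. *)
Lemma npart_conj k N :
  npart (fun s => k <= size s) N = npart (fun s => k <= largest s) N.
Proof.
suff conj_le (Q1 Q2 : pred (seq nat)) :
    (forall s, is_intpart N s -> Q1 s -> Q2 (conj_part s)) ->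
    npart Q1 N <= npart Q2 N.
  by apply/eqP; rewrite eqn_leq; apply/andP; split;
    apply: conj_le => s /and3P[so s0 _];
    have [_ sz hd] := conj_partP so s0; rewrite /largest ?sz ?hd.
move=> Q12; rewrite /npart -!size_filter -(size_map conj_part).
apply: uniq_leq_size.
  rewrite map_inj_in_uniq ?filter_uniq ?uniq_partitions // => s t.
  rewrite !mem_filter !mem_partitions =>
    /andP[_ /and3P[? ? _]] /andP[_ /and3P[? ? _]].
  exact: conj_part_inj.
move=> _ /mapP[s + ->]; rewrite !mem_filter !mem_partitions => /andP[Qs sN].
by rewrite Q12 //=; have /and3P[so s0 /eqP <-] := sN; case: (conj_partP so s0).
Qed.

(* For [j > 0], a partition with [j] ones has crank >= r iff at least [r + j]
   of its parts exceed [j].  The pair ([j], partition without these ones) is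
   here relaxed to an arbitrary pair of total size [N]: this multiplies the
   series C_r by 1 / (1 - q), and the bijection behind the recurrence for C_r
   then has no exceptional cases. *)
Definition pairs N := [seq (j, s) | j <- iota 0 N.+1, s <- partitions (N - j)].

Lemma mem_pairs N j s :
  ((j, s) \in pairs N) = [&& sorted geq s, 0 \notin s & j + sumn s == N].
Proof.
apply/allpairsPdep/idP => [[i [t [iN]]]|/and3P[so s0 /eqP sN]].
  move: iN; rewrite mem_iota add0n ltnS mem_partitions /= => iN.
  by case/and3P=> to t0 /eqP tN [-> ->]; rewrite to t0 tN subnKC /=.
exists j, s; rewrite mem_iota add0n ltnS mem_partitions /is_intpart so s0 -sN.
by rewrite leq_addr addKn eqxx.
Qed.

Lemma uniq_pairs N : uniq (pairs N).
Proof.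
apply: allpairs_uniq_dep => [|j _|[i s] [j t] _ _ /= [-> ->]] //.
  exact: iota_uniq.
exact: uniq_partitions.
Qed.

Lemma count_pairs N (Q : nat -> pred (seq nat)) :
  count (fun p => Q p.1 p.2) (pairs N) = \sum_(j < N.+1) npart (Q j) (N - j).
Proof.
rewrite count_flatten sumnE !big_map
  -(big_mkord predT (fun j => npart (Q j) (N - j))).
by rewrite /index_iota subn0; apply: eq_bigr => j _; rewrite count_map.
Qed.

Definition pair_crank_ge s : pred (nat * seq nat) :=
  fun p => s + p.1 <= count (ltn p.1) p.2.

Lemma sorted_split j s : sorted geq s ->
  s = [seq x <- s | j < x] ++ [seq x <- s | x <= j].
Proof.
elim: s => //= x s IHs so; case: (ltnP j x) => [_|xj] /=.
  by congr cons; apply: IHs (path_sorted so).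
move: so; rewrite path_sortedE; last exact: geqn_trans.
case/andP=> /allP sx _.
have e P : all P s -> [seq x <- s | P x] = s by move/all_filterP.
rewrite [X in X ++ _](_ : _ = [::]).
  by rewrite e //; apply/allP => y /sx /= /leq_trans; apply.
apply/eqP; rewrite -size_eq0 size_filter -leqn0 leqNgt -has_count;
  apply/hasPn => y /sx /= yx.
by rewrite -leqNgt (leq_trans yx).
Qed.

(* With [t] parts of [nu] larger than [j], subtract 1 from each of them, insert
   the part [j] after them and take [t - s] as the new parameter.  Conversely
   [j] is the part of index [t = s + j'], or 0 if there is none. *)
Definition pair_shift s (p : nat * seq nat) : nat * seq nat :=
  (count (ltn p.1) p.2 - s,
   [seq x <- map predn [seq x <- p.2 | p.1 < x] ++
             p.1 :: [seq x <- p.2 | x <= p.1] | 0 < x]).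

Definition pair_unshift s (p : nat * seq nat) : nat * seq nat :=
  let t := s + p.1 in
  (nth 0 p.2 t, add_column t (take t p.2) ++ drop t.+1 p.2).

Lemma sumn_gt_pred j s : all (ltn j) s -> sumn (map predn s) + size s = sumn s.
Proof. by elim: s => //= x s IHs /andP[jx /IHs]; lia. Qed.

Lemma size_le_sumn s : 0 \notin s -> size s <= sumn s.
Proof.
by elim: s => //= x s IHs; rewrite inE negb_or => /andP[x0 /IHs]; lia.
Qed.

(** With [t] parts above [j], the parts lose [t] and gain [j], and the parameter becomes [t - s]:
    the total drops by [s]. As [j <= t - s], only the first [t] parts can exceed the new
    parameter. *)
Lemma pair_shiftP s N j nu : (j, nu) \in pairs N -> pair_crank_ge s (j, nu) ->
  [/\ s <= N, pair_shift s (j, nu) \in pairs (N - s),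
      ~~ pair_crank_ge s.+1 (pair_shift s (j, nu))
    & pair_unshift s (pair_shift s (j, nu)) = (j, nu)].
Proof.
rewrite mem_pairs => /and3P[so n0 /eqP sumN];
  rewrite /pair_crank_ge /pair_shift /= => le_t.
rewrite -size_filter in le_t *.
set A := filter (ltn j) nu; set B := [seq x <- nu | x <= j].
have nuE : nu = A ++ B := sorted_split j so.
have jA : all (ltn j) A by exact: filter_all.
have jB : all (geq j) B by exact: filter_all.
have sA := sumn_gt_pred jA.
have sumAB : sumn nu = sumn A + sumn B by rewrite nuE sumn_cat.
have szA : size A <= sumn A.
  by apply: size_le_sumn; apply: contra n0; rewrite mem_filter => /andP[].
have leA : s + j <= size A := le_t.
have tE : s + (size A - s) = size A by lia.
(* For [j = 0] the inserted part is filtered out and the map just drops a column; the default value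
   of [nth] then recovers [j = 0]. *)
have [j0|j_gt0] := posnP j.
  have B0 : B = [::].
    apply/eqP; rewrite -size_eq0 size_filter -leqn0 leqNgt -has_count;
      apply/hasPn => y yn /=.
    by rewrite j0 leqn0; apply: contraNneq n0 => <-.
  have nuA : nu = A by rewrite {1}nuE B0 cats0.
  have -> : filter (ltn 0) (map predn A ++ j :: B) = drop_column nu.
    by rewrite B0 j0 filter_cat /= cats0 -nuA.
  have dnu := @intpart_drop_column N nu _.
  have /dnu/and3P[dso d0 /eqP dsum] : is_intpart N nu.
    by rewrite /is_intpart so n0 -sumN j0 add0n eqxx.
  split.
  - by lia.
  - by rewrite mem_pairs dso d0 dsum -nuA; apply/eqP; rewrite nuA; lia.
  - rewrite -ltnNge addSn tE ltnS (leq_trans (count_size _ _)) //.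
    by rewrite -nuA size_drop_column.
  rewrite /pair_unshift /= tE -nuA take_oversize ?size_drop_column //
    drop_oversize; last first.
    by rewrite ltnW // ltnS size_drop_column.
  by rewrite nth_default ?size_drop_column // cats0 drop_columnK // j0.
have catP x : x \in map predn A ++ j :: B -> 0 < x.
  rewrite mem_cat inE => /or3P[/mapP[y yA ->]|/eqP->//|xB].
    by have /= := allP jA y yA; lia.
  by apply: (@mem_pos nu) n0 _; move: xB; rewrite mem_filter => /andP[].
have -> : filter (ltn 0) (map predn A ++ j :: B) = map predn A ++ j :: B.
  by apply/all_filterP/allP => x; exact: catP.
split.
- by lia.
- rewrite mem_pairs; apply/and3P; split.
  + move: so; rewrite !geq_pairwise {1}nuE !pairwise_cat pairwise_map /= =>
    /and3P[_ pA pB].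
    rewrite jB pB !andbT; apply/andP; split; last first.
      by apply: sub_pairwise pA => x y /=; lia.
    apply/allrelP => _ y /mapP[x xA ->] yjB.
    have /= jx := allP jA x xA.
    have : y <= j.
      by move: yjB; rewrite inE => /predU1P[->//|yB]; exact: (allP jB).
    by rewrite /=; lia.
  + by apply/negP => /catP.
  by rewrite sumn_cat /=; apply/eqP; lia.
- have le_j : j <= size A - s by lia.
  rewrite -ltnNge addSn tE ltnS count_cat /= ltnNge le_j /=
    (_ : count _ B = 0); last first.
    apply/eqP; rewrite eqn0Ngt -has_count; apply/hasPn => y /(allP jB) /= yj.
    by rewrite -leqNgt (leq_trans yj).
  by rewrite !addn0 (leq_trans (count_size _ _)) ?size_map.
rewrite /pair_unshift /= tE.
have szp : size (map predn A) = size A by rewrite size_map.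
rewrite nth_cat szp ltnn subnn /= take_cat szp ltnn subnn take0 cats0.
rewrite -cat_rcons drop_cat size_rcons szp ltnn subnn drop0.
congr (_, _); rewrite nuE; congr cat.
rewrite /add_column szp subnn cats0 -map_comp -[RHS]map_id;
  apply/eq_in_map => x xA /=.
by have /= := allP jA x xA; lia.
Qed.

Lemma pair_unshiftP s N j nu : (j, nu) \in pairs (N - s) ->
  s <= N -> ~~ pair_crank_ge s.+1 (j, nu) ->
  [/\ pair_unshift s (j, nu) \in pairs N,
      pair_crank_ge s (pair_unshift s (j, nu))
    & pair_shift s (pair_unshift s (j, nu)) = (j, nu)].
Proof.
rewrite mem_pairs => /and3P[so n0 /eqP sumN] lesN.
rewrite /pair_crank_ge -ltnNge addSn ltnS /pair_unshift /pair_shift /=;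
  set t := s + j => le_t.
have [le_nu|lt_nu] := leqP (size nu) t.
  rewrite nth_default // take_oversize // drop_oversize ?leqW // cats0.
  have /and3P[co c0 /eqP csum] : is_intpart (sumn nu + t) (add_column t nu).
    by apply: intpart_add_column; rewrite // /is_intpart so n0 eqxx.
  have filt : filter (ltn 0) (add_column t nu) = add_column t nu.
    exact: filter_pos.
  rewrite -size_filter filt size_add_column //; split.
  - by rewrite mem_pairs co c0 csum; apply/eqP; lia.
  - by rewrite addn0 leq_addr.
  rewrite addKn (_ : [seq x <- _ | x <= 0] = [::]); last first.
    apply/eqP; rewrite -size_eq0 size_filter -leqn0 leqNgt -has_count;
      apply/hasPn => y yn /=.
    by rewrite leqn0; apply: contraNneq c0 => <-.
  by rewrite filter_cat /= cats0 -[filter _ (map _ _)]/(drop_column _)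
    add_columnK.
set w := nth 0 nu t.
have nuE : nu = take t nu ++ w :: drop t.+1 nu.
  by rewrite -drop_nth // cat_take_drop.
set A := take t nu in nuE *; set B := drop t.+1 nu in nuE *.
have szA : size A = t by rewrite size_take lt_nu.
have [wA wB pA pB] :
    [/\ all (leq w) A, all (geq w) B, pairwise geq A & pairwise geq B].
  move: so; rewrite geq_pairwise nuE pairwise_cat /= =>
    /and3P[rAB pA /andP[wB pB]].
  split=> //; apply/allP => x xA; apply: (allrelP rAB) => //; exact: mem_head.
have w_gt0 : 0 < w by rewrite lt0n; apply: contraNneq n0 => <-; rewrite mem_nth.
have A0 : 0 \notin A by apply: contra n0; exact: mem_take.
have B0 : 0 \notin B by apply: contra n0; exact: mem_drop.
(* Otherwise the first [t] parts and [w] would be [t + 1] parts above [j]. *)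
have le_wj : w <= j.
  rewrite leqNgt; apply: contraTN le_t => ltjw;
    rewrite -ltnNge nuE count_cat /= ltjw.
  rewrite (_ : count (ltn j) A = t) ?addnS ?ltnS ?leq_addr // -szA; apply/eqP;
    rewrite -all_count.
  by apply/allP => x /(allP wA) /=; apply: leq_trans.
rewrite /add_column szA subnn cats0.
have fA : [seq x <- map succn A ++ B | w < x] = map succn A.
  rewrite filter_cat (_ : [seq x <- B | w < x] = [::]) ?cats0.
    by apply/all_filterP; rewrite all_map.
  apply/eqP; rewrite -size_eq0 size_filter -leqn0 leqNgt -has_count;
    apply/hasPn => y /(allP wB) /=.
  by rewrite leqNgt.
have fB : [seq x <- map succn A ++ B | x <= w] = B.
  rewrite filter_cat (_ : [seq x <- map succn A | x <= w] = [::]) /=.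
    by apply/all_filterP.
  apply/eqP; rewrite -size_eq0 size_filter -leqn0 leqNgt -has_count;
    apply/hasPn => _ /mapP[y /(allP wA) wy ->].
  by rewrite -ltnNge ltnS.
have sumS : sumn (map succn A) = sumn A + t.
  by rewrite -szA; elim: (A) => //= x u ->; lia.
rewrite -size_filter fA fB size_map szA; split.
- rewrite mem_pairs; apply/and3P; split.
  + rewrite geq_pairwise pairwise_cat pairwise_map pA pB !andbT.
    apply/allrelP => _ y /mapP[x /(allP wA) wx ->] /(allP wB) /= yw; lia.
  + by rewrite mem_cat negb_or B0 andbT; apply/mapP => -[].
  by rewrite sumn_cat sumS; move: sumN; rewrite nuE sumn_cat /= => sumN;
    apply/eqP; lia.
- by rewrite leq_add2l.
rewrite addKn -map_comp map_id -nuE filter_pos //.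
Qed.

Definition pair_count s N := count (pair_crank_ge s) (pairs N).

Lemma pair_count_rec s N :
  pair_count s N = shift s (fun M => size (pairs M) - pair_count s.+1 M) N.
Proof.
rewrite /shift; case: leqP => [lesN|ltNs]; last first.
  rewrite /pair_count; apply/eqP; rewrite eqn0Ngt -has_count;
    apply/hasPn => -[j nu] jN.
  by apply: contraTN ltNs => /(pair_shiftP jN)[]; rewrite -leqNgt.
rewrite /pair_count -(count_predC (pair_crank_ge s.+1)) addKn.
apply: (@count_bij _ _ _ _ _ _ (pair_shift s) (pair_unshift s));
  rewrite ?uniq_pairs //.
  by move=> [j nu] jN cN; case: (pair_shiftP jN cN).
by move=> [j nu] jN cN; case: (pair_unshiftP jN lesN cN).
Qed.

(** * From pairs back to cranks *)

Lemma ones_eq0 s : (ones s == 0) = (1 \notin s).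
Proof. by rewrite /ones eqn0Ngt -has_count has_pred1. Qed.

Lemma ones_rcons s : ones (rcons s 1) = (ones s).+1.
Proof. by rewrite /ones -cats1 count_cat /= addn1. Qed.

Lemma npart_ones N j (Q : pred (seq nat)) :
  (forall s, Q (rcons s 1) = Q s) -> j <= N ->
  npart (fun s => (ones s == j) && Q s) N
  = npart (fun s => (1 \notin s) && Q s) (N - j).
Proof.
move=> Q1; elim: j N => [|j IHj] N.
  by rewrite subn0; under eq_npart do rewrite ones_eq0.
case: N => // N lejN.
transitivity (npart (fun s => (1 \in s) && ((ones s == j.+1) && Q s)) N.+1).
  apply: eq_npart => s _; rewrite -[1 \in s]negbK -ones_eq0.
  by case: eqP => [->|]; rewrite ?andbF.
rewrite npart_rcons1 subSS -IHj //; apply: eq_npart => s _.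
by rewrite ones_rcons eqSS Q1.
Qed.

Definition crank_ge r s :=
  if ones s == 0 then r <= largest s else r + ones s <= mu s.

(* For [j > 0], having exactly [j] ones is counted by a difference since adding
   a part 1 does not affect the parts larger than [j]; for [j = 0] conjugation
   turns the number of parts into the largest part. *)
Lemma crank_ge_pair_count r N : 0 < r ->
  npart (crank_ge r) N.+2 + pair_count r N.+1 = pair_count r N.+2.
Proof.
move=> r_gt0; pose Q j s := r + j <= count (ltn j) s.
have -> : npart (crank_ge r) N.+2 =
    \sum_(j < N.+3) npart (fun s => (ones s == j) && crank_ge r s) N.+2.
  rewrite npart_sum; under [RHS]eq_bigr do rewrite npart_sum.
  rewrite [RHS]exchange_big /=; apply: eq_big_seq => s;
    rewrite mem_partitions => sN.
  have les : ones s < N.+3.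
    have /and3P[_ s0 /eqP <-] := sN; rewrite ltnS.
    by apply: leq_trans (size_le_sumn s0); exact: count_size.
  rewrite (bigD1 (Ordinal les)) //= eqxx big1 ?addn0 // => j /negPf jP.
  by rewrite -[ones s]/(val (Ordinal les)) eq_sym (inj_eq val_inj) jP.
rewrite /pair_count !(count_pairs _ Q) big_ord_recr [RHS]big_ord_recr /=.
rewrite addnAC -big_split /=; congr (_ + _); last first.
  rewrite subnn /Q [RHS]npart_eq0; last first.
    move=> s /and3P[_ s0 /eqP sN]; have := size_le_sumn s0.
    by rewrite sN leqn0 size_eq0 => /eqP->; rewrite addnS.
  apply: npart_eq0 => s /and3P[_ s0 /eqP sN]; apply/andP => -[/eqP oN].
  rewrite /crank_ge oN /= => ler.
  have := leq_trans (leq_trans ler (count_size _ _)) (size_le_sumn s0).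
  by rewrite sN addnC leqNgt -[ltnLHS]addn0 ltn_add2l r_gt0.
apply: eq_bigr => -[j /= lejN] _; case: j lejN => [|j] lejN.
  have QE M : npart (Q 0) M = npart (fun s => r <= largest s) M.
    rewrite -npart_conj; apply: eq_npart => s /and3P[_ s0 _].
    by rewrite /Q addn0 -size_filter filter_pos.
  rewrite !subn0 !QE -(npart_noones N.+1 (fun s => r <= largest s));
    congr (_ + _); apply: eq_npart.
    by move=> s _; rewrite -ones_eq0 /crank_ge; case: eqP.
  (* Appending 1 preserves the largest part of a nonempty partition only; here the size is
     [N.+1 > 0]. *)
  by case.
have Q1 s : Q j.+1 (rcons s 1) = Q j.+1 s.
  by rewrite /Q -cats1 count_cat /= !addn0.
have -> : N.+2 - j.+1 = (N.+1 - j.+1).+1 by lia.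
rewrite -(npart_noones _ (Q j.+1)).
congr (_ + _); last by apply: eq_npart => s _; rewrite Q1.
have -> : (N.+1 - j.+1).+1 = N.+2 - j.+1 by lia.
rewrite -npart_ones //; last by lia.
apply: eq_npart => s _; rewrite /crank_ge /Q /mu.
by case: eqP => // ->.
Qed.

Local Open Scope ring_scope.

(** * Generating functions *)

Section GeneratingFunction.

Variables (A : comNzRingType) (q : A) (K : nat).
Hypothesis qX_eq0 : q ^+ K.+1 = 0.

Definition gf (a : nat -> nat) : A := \sum_(i < K.+1) (a i)%:R * q ^+ i.

Lemma eq_gf a b : a =1 b -> gf a = gf b.
Proof. by move=> ab; apply: eq_bigr => i _; rewrite ab. Qed.

Lemma gfD a b : gf (fun n => a n + b n)%N = gf a + gf b.
Proof. by rewrite -big_split; apply: eq_bigr => i _; rewrite natrD mulrDl. Qed.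

Lemma gfZ c a : gf (fun n => c * a n)%N = c%:R * gf a.
Proof. by rewrite mulr_sumr; apply: eq_bigr => i _; rewrite natrM mulrA. Qed.

Lemma gf_sum (r : seq nat) (F : nat -> nat -> nat) :
  gf (fun n => \sum_(s <- r) F s n)%N = \sum_(s <- r) gf (F s).
Proof.
rewrite [RHS]exchange_big; apply: eq_bigr => i _.
by rewrite natr_sum mulr_suml.
Qed.

Lemma gf_shift j a : gf (shift j a) = q ^+ j * gf a.
Proof.
elim: j => [|j IHj].
  by rewrite mul1r; apply: eq_gf => n; rewrite /shift subn0.
rewrite exprS -mulrA -IHj /gf mulr_sumr big_ord_recl [RHS]big_ord_recr /=.
rewrite {1}/shift /= mul0r add0r mulrCA -exprS qX_eq0 mulr0 addr0.
by apply: eq_bigr => i _; rewrite mulrCA -exprS; congr (_%:R * _).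
Qed.

End GeneratingFunction.

Lemma pair_total_rec N :
  size (pairs N)
  = (npart (all (leq 1)) N + shift 1 (fun M => size (pairs M)) N)%N.
Proof.
have pairsE M : size (pairs M) = (\sum_(j < M.+1) npart predT (M - j))%N.
  by rewrite -count_predT (count_pairs _ (fun=> predT)).
have -> : npart (all (leq 1)) N = npart predT N.
  by apply: eq_npart => s /all_leq1_intpart.
rewrite pairsE big_ord_recl subn0; congr addn.
by case: N => [|N]; rewrite /shift ?big_ord0 //= pairsE subn1.
Qed.

(** The crank series is [1 - q] times that of [pair_count]. Negative terms are moved across the
    equation, as the coefficients are natural numbers. *)
Lemma spt_combination_gf (A : comNzRingType) (q : A) (v : nat -> A) K M :
  (forall n, (0 < n)%N -> (1 - q ^+ n) * v n = 1) ->
  q ^+ K.+1 = 0 -> (K.*2 < M)%N ->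
  gf q K (fun N => \sum_(1 <= n < M.+1) spt_with_smallest n N +
    \sum_(1 <= s < M.+1)
      (s.*2.-1) * (shift 1 (pair_count s) N + npart (rank_ge s) N))%N
  = gf q K (fun N => \sum_(1 <= s < M.+1) (s.*2.-1) * pair_count s N)%N.
Proof.
move=> vK qX ltKM.
rewrite gfD !gf_sum.
rewrite (andrews_spt_identity vK qX (P := fun n => gf q K (npart (all (leq n))))
  (Z := fun n => gf q K (spt_with_smallest n))
  (G := fun s => gf q K (npart (rank_ge s)))
  (C := fun s => (1 - q) * gf q K (pair_count s))) //.
- rewrite -big_split /=; apply: eq_bigr => s _; rewrite !gfZ -mulrDr gfD;
  congr (_ * _).
  by rewrite gf_shift // expr1; ring.
- move=> n n_gt0; rewrite -gf_shift // -gfD; apply: eq_gf => N;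
  exact: npart_ge_rec.
- by move=> n n_gt0; rewrite mulrDr -!gf_shift // -gfD; apply: eq_gf => N;
  exact: spt_with_smallest_rec.
- move=> s s_gt0; rewrite addn1.
  rewrite (eq_gf _ _ (fun N => rank_ge_rec N s_gt0)) // gf_shift //;
    congr (_ * _).
  apply/eqP; rewrite eq_sym subr_eq -gfD; apply/eqP/eq_gf => N.
  rewrite [RHS]addnC (@eq_npart _ _ predT) => [|t /all_leq1_intpart //].
  rewrite (npart_split N (rank_ge (s + 3)) predT).
  by congr addn; apply: eq_npart => t _; rewrite andbT.
move=> s s_gt0; rewrite (eq_gf _ _ (pair_count_rec s)) gf_shift // addn1
  mulrCA; congr (_ * _).
have -> : gf q K (npart (all (leq 1))) =
    (1 - q) * gf q K (fun N => size (pairs N)).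
  rewrite mulrBl mul1r -[q in q * _]expr1 -gf_shift //; apply/eqP;
    rewrite eq_sym subr_eq -gfD.
  by apply/eqP/eq_gf => N; rewrite pair_total_rec.
rewrite -mulrBr; congr (_ * _); apply/eqP; rewrite eq_sym subr_eq -gfD;
  apply/eqP/eq_gf => N.
by rewrite subnK // count_size.
Qed.

(** The series has degree at most [K], so it is its own reduced representative modulo [X^(K+1)] and
    its top coefficient can be read off. *)
Lemma gf_qpoly_inj K (a b : nat -> nat) :
  gf ('qX : {poly %/ ('X^(K.+1) : {poly int})}) K a = gf 'qX K b -> a K = b K.
Proof.
have gfE c : gf ('qX : {poly %/ ('X^(K.+1) : {poly int})}) K c
    = in_qpoly 'X^(K.+1) (\poly_(i < K.+1) (c i)%:R).
  rewrite (_ : \poly_(i < _) _ = \sum_(i < K.+1) (c i)%:R * 'X^i); last first.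
    by rewrite poly_def; apply: eq_bigr => i _; rewrite scaler_nat mulr_natl.
  by rewrite rmorph_sum; apply: eq_bigr => i _;
    rewrite rmorphM rmorphXn rmorph_nat.
have szE : size (mk_monic ('X^(K.+1) : {poly int})) = K.+2.
  by rewrite mk_monic_Xn size_polyXn.
have coefE c :
    (gf ('qX : {poly %/ ('X^(K.+1) : {poly int})}) K c : {poly int})`_K
    = (c K)%:R.
  rewrite gfE in_qpoly_small ?coef_poly ?ltnSn // szE ltnS.
  exact: size_poly.
by move=> ab; apply/eqP; rewrite -(eqr_nat int) -!coefE ab.
Qed.

Lemma qpolyX_expn_eq0 K :
  ('qX : {poly %/ ('X^(K.+1) : {poly int})}) ^+ K.+1 = 0.
Proof.
rewrite /qpolyX -rmorphXn /=; apply: val_inj => /=.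
by rewrite mk_monic_Xn Pdiv.RingMonic.rmodpp // monicXn.
Qed.

Lemma qpoly_one_subX_inv K n : (0 < n)%N ->
  let q := 'qX : {poly %/ ('X^(K.+1) : {poly int})} in
  (1 - q ^+ n) * (\sum_(i < K.+1) q ^+ n ^+ i) = 1.
Proof.
move=> n_gt0 q; apply: oppr_inj; rewrite -mulNr opprB -subrX1 exprAC.
by rewrite qpolyX_expn_eq0 expr0n gtn_eqF // sub0r.
Qed.

Lemma andrews_spt_crank_rank N M : (N.+2.*2 < M)%N ->
  (spt N.+2 + \sum_(1 <= s < M.+1) (s.*2.-1) * npart (rank_ge s) N.+2
  = \sum_(1 <= s < M.+1) (s.*2.-1) * npart (crank_ge s) N.+2)%N.
Proof.
move=> ltM.
have := gf_qpoly_inj (spt_combination_gf (@qpoly_one_subX_inv N.+2)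
  (qpolyX_expn_eq0 _) ltM).
rewrite -spt_sum_smallest //; last by lia.
rewrite {1}/shift /= subn1 /=.
under [X in _ = X]eq_big_nat => s /andP[s_gt0 _].
  rewrite -crank_ge_pair_count // mulnDr.
  over.
under [X in (_ + X)%N = _]eq_bigr do rewrite mulnDr.
rewrite !big_split /= addnCA [RHS]addnC => /eqP.
by rewrite eqn_add2l => /eqP.
Qed.

(** * First positive moments as sums of threshold counts *)

Lemma sum_nat_thresholds k M : (k <= M)%N ->
  (\sum_(1 <= s < M.+1) (s <= k))%N = k.
Proof.
move=> lekM; rewrite (big_cat_nat (n := k.+1)) //= [X in (_ + X)%N]big1_seq;
  last first.
  by move=> s /=; rewrite mem_index_iota ltnNge => /andP[/negPf->].
rewrite addn0 (eq_big_nat _ _ (F2 := fun=> 1%N)) ?sum_nat_const_nat ?muln1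
  ?subSS ?subn0 //.
by move=> s /andP[_]; rewrite ltnS => ->.
Qed.

(** A positive value [k] is counted once for each threshold [1 <= s <= k]; values at most 0 meet no
    threshold. *)
Lemma positive_moment (f : seq nat -> int) N M :
  (forall s, is_intpart N s -> f s <= N%:Z) -> (N <= M)%N ->
  \sum_(1 <= m < N.+1) m%:Z ^+ 1 * (npart (fun s => f s == m%:Z) N)%:Z
  = (\sum_(1 <= s < M.+1) npart (fun t => (s%:Z <= f t)%R) N)%:Z.
Proof.
move=> f_le leNM.
transitivity ((\sum_(1 <= m < N.+1) m * npart (fun s => f s == m%:Z) N)%N%:Z).
  by rewrite -!natz natr_sum; apply: eq_bigr => m _; rewrite expr1 natrM !natz.
congr Posz; under eq_bigr do rewrite npart_sum big_distrr /=.
under [RHS]eq_bigr do rewrite npart_sum.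
rewrite exchange_big [RHS]exchange_big /=; apply: eq_big_seq => t;
  rewrite mem_partitions => /f_le.
case: (f t) => [k|k] lekN; last by rewrite !big1 // => m _; rewrite ?muln0.
rewrite sum_nat_thresholds ?(leq_trans lekN) //.
case: (posnP k) => [->|k_gt0].
  by rewrite big1_seq // => -[|m] _; rewrite ?muln0.
rewrite (bigD1_seq k) ?iota_uniq ?mem_index_iota ?k_gt0 //= eqxx muln1 big1
  ?addn0 // => m.
by rewrite eqz_nat eq_sym => /negPf->; rewrite muln0.
Qed.

Lemma rank_moment1 N M : (N <= M)%N ->
  rank_moment 1 N = (\sum_(1 <= s < M.+1) npart (rank_ge s) N)%:Z.
Proof.
move=> leNM; transitivity
    (\sum_(1 <= m < N.+1) m%:Z ^+ 1 * (npart (fun s => rank s == m%:Z) N)%:Z).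
  apply: eq_bigr => m _.
  by rewrite /rank_count (card_intpart N (fun s => rank s == m%:Z)).
rewrite (positive_moment (M := M)) //.
  congr Posz; apply: eq_bigr => s _; apply: eq_npart => t _.
  by rewrite /rank lerBrDr -PoszD lez_nat addnC.
by move=> s sN; exact: (rank_le (IntPart sN)).
Qed.

Lemma crank_moment1 N M : N != 1%N -> (N <= M)%N ->
  crank_moment 1 N = (\sum_(1 <= s < M.+1) npart (crank_ge s) N)%:Z.
Proof.
move=> /negPf N_neq1 leNM.
transitivity
    (\sum_(1 <= m < N.+1) m%:Z ^+ 1 * (npart (fun s => crank s == m%:Z) N)%:Z).
  apply: eq_bigr => m _.
  by rewrite /crank_count N_neq1 (card_intpart N (fun s => crank s == m%:Z)).
rewrite (positive_moment (M := M)) //.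
  congr Posz; apply: eq_bigr => s _; apply: eq_npart => t _.
  by rewrite /crank /crank_ge; case: ifP => _; rewrite ?lerBrDr -?PoszD lez_nat.
by move=> s sN; exact: (crank_le (IntPart sN)).
Qed.

Theorem lemma5p4 (N : nat) (hN : (1 <= N)%N) :
  (ospt N = (spt N)%:Z %[mod 2])%Z.
Proof.
case: N hN => [|[|N]] // _.
  (* [N = 1] is computed directly because of the crank convention there. *)
  rewrite /ospt (rank_moment1 (M := 1)) // (@spt_sum_smallest 1 1) //
    /crank_moment !big_nat1.
  by rewrite /crank_count /spt_with_smallest /npart /= unlock.
pose M := (N.+2.*2).+1.
have := @andrews_spt_crank_rank N M (ltnSn _).
rewrite /ospt (@rank_moment1 _ M) ?(@crank_moment1 _ M) //;
  try by rewrite /M; lia.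
(* The weights [2s - 1 = 1 + 2(s - 1)] are odd, so modulo 2 the weighted sums reduce to the first
   moments. *)
have split_odd (a : nat -> nat) : (\sum_(1 <= s < M.+1) s.*2.-1 * a s =
    \sum_(1 <= s < M.+1) a s + 2 * \sum_(1 <= s < M.+1) s.-1 * a s)%N.
  rewrite big_distrr -big_split; apply: eq_big_nat => -[|s] // _ /=.
  by lia.
rewrite !split_odd => sptE; apply/eqP; rewrite eqz_mod_dvd; apply/dvdzP.
exists ((\sum_(1 <= s < M.+1) s.-1 * npart (rank_ge s) N.+2)%N%:Z
  - (\sum_(1 <= s < M.+1) s.-1 * npart (crank_ge s) N.+2)%N%:Z).
lia.
Qed.
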